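(* Let $K$ be a real number field with $s\ge 1$ real embeddings and $2t\ge 0$ non-real embeddings into $\mathbb{C}$. Then $\operatorname{card}(C_K)\ge 2^{s+t-1}$, where $C_K$ is the set of differences of consecutive Pisot numbers generating $K$ (defined precisely in the context).
   Context: A real number field $K$ is a subfield of $\mathbb{R}$ of finite degree $d=s+2t\ge 1$ over $\mathbb{Q}$, where $s$ is the number of real embeddings and $2t$ the number of non-real embeddings of $K$ into $\mathbb{C}$. A Pisot number is a real algebraic integer greater than $1$ whose other conjugates over $\mathbb{Q}$ are all of modulus less than $1$ (so every rational integer $\ge2$ is a Pisot number); $S$ is the set of Pisot numbers, and $$\wp_K:=\{\theta : \theta\in S\cap K \text{ and } K=\mathbb{Q}(\theta)\}.$$ Let $\theta_1<\theta_2<\theta_3<\cdots$ denote the elements of $\wp_K$ in increasing order ($\wp_K$ is an infinite discrete subset of $[1,\infty)$). Define $$C_K:=\{\theta_{n+1}-\theta_n : n\in\mathbb{N}\},$$ where $\mathbb{N}$ denotes the positive integers. *)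

(* Defs.v *)
From mathcomp Require Import all_boot all_order all_algebra all_field.
From mathcomp Require Import complex.
From mathcomp Require Import boolp classical_sets functions cardinality reals.

Set Implicit Arguments.
Unset Strict Implicit.
Unset Printing Implicit Defensive.

Import Order.TTheory GRing.Theory Num.Theory.

Local Open Scope classical_set_scope.
Local Open Scope ring_scope.
Local Open Scope complex_scope.

Definition min_polyQ (F : fieldType) (p : {poly rat}) (x : F) : Prop :=
  [/\ p \is monic, irreducible_poly p & root (map_poly ratr p) x].

Definition conjugateQ (R : realType) (x : R) (z : R[i]) : Prop :=
  exists2 p : {poly rat}, min_polyQ p x & root (map_poly ratr p) z.

Definition pisot (R : realType) (x : R) : Prop :=
  [/\ integralOver (intr : int -> R) x, 1 < x &
      forall z : R[i], conjugateQ x z -> z != x%:C -> `|z| < 1].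

(* A subfield of R of finite degree over the rationals is presented as a finite
   extension K of rat together with a (necessarily injective) ring morphism
   iota : K -> R; the subfield itself is the range of iota. *)

(* The elements of wpK live in R: they are the Pisot numbers of the form iota x
   where x generates K as a field over rat. *)
Definition wpK (R : realType) (K : fieldExtType rat)
    (iota : {rmorphism K -> R}) : set R :=
  [set theta | pisot theta /\
     exists2 x : K, iota x = theta & <<1; x>>%VS = {:K}%VS].

Definition increasing_enum (R : realType) (A : set R) (theta : nat -> R) : Prop :=
  {homo theta : m n / (m < n)%N >-> m < n} /\ range theta = A.

(* An increasing enumeration is unique when it exists, so it is legitimate to
   quantify over it existentially; the indexing starts at 0. *)
Definition CK (R : realType) (K : fieldExtType rat)
    (iota : {rmorphism K -> R}) : set R :=
  [set delta | exists2 theta : nat -> R, increasing_enum (wpK iota) theta &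
     exists n : nat, delta = theta n.+1 - theta n].

Definition embeddings (R : realType) (K : fieldExtType rat) : set (K -> R[i]) :=
  [set f : K -> R[i] |
     exists sigma : {rmorphism K -> R[i]}, f = sigma :> (K -> R[i])].
Arguments embeddings : clear implicits.

Definition real_embeddings (R : realType) (K : fieldExtType rat) :
    set (K -> R[i]) :=
  [set f | embeddings R K f /\ forall x, f x \is Num.real].
Arguments real_embeddings : clear implicits.

Definition nonreal_embeddings (R : realType) (K : fieldExtType rat) :
    set (K -> R[i]) :=
  [set f | embeddings R K f /\ ~ forall x, f x \is Num.real].
Arguments nonreal_embeddings : clear implicits.

(* Main.v *)
Require Import Defs.
From HB Require Import structures.
From mathcomp Require Import all_boot all_order all_algebra all_field.
From mathcomp Require Import ring lra complex.
From mathcomp Require Import boolp classical_sets functions cardinality reals.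

(** Let [sg] be the embeddings of [K], with [sg ord0] the given one
    [iota].  The elements of [wpK] are the [iota y] with [y] an algebraic integer,
    [iota y > 1] and [|sg k y| < 1] for [k != 0].  Algebraic integers can be
    chosen with all [sg k theta], [k != 0], as close as we like to prescribed
    real values (equal at conjugate places) and [iota theta] large: multiply a
    rounded real solution by an integer of [K] whose conjugates, apart from
    [iota], are tiny.

    Fix signs [s k].  Take [beta] with [sg k beta] near [s k], then [theta] in
    [wpK] with [sg k theta] extremely close to [- s k].  As [theta + beta] is again
    in [wpK], the gap [delta] following [theta] is at most [iota beta], so the
    norm bounds all [|sg k delta|] below, independently of the precision chosen
    for [theta].  Since [sg k (theta + delta)] lies in the unit disc while
    [sg k theta] is almost [- s k], the real part of [sg k delta] has the sign
    [s k].  So every sign pattern on the [s + t - 1] archimedean places other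
    than [iota] comes from a gap, and different patterns from different gaps. *)

Set Implicit Arguments.
Unset Strict Implicit.
Unset Printing Implicit Defensive.

Import Order.TTheory GRing.Theory Num.Theory.

Local Open Scope classical_set_scope.
Local Open Scope ring_scope.
Local Open Scope card_scope.
Local Open Scope complex_scope.

(** * Number fields and their embeddings *)

Lemma map_poly_ratr (F : fieldType) (rT : unitRingType)
    (f : {rmorphism F -> rT}) (p : {poly rat}) :
  map_poly f (map_poly ratr p) = map_poly ratr p.
Proof.
by apply/polyP => i; rewrite !coef_map_id0 ?rmorph0 ?fmorph_rat //;
  rewrite /ratr ?mul0r.
Qed.

Lemma map_poly_in_alg (K : fieldExtType rat) (p : {poly rat}) :
  map_poly (in_alg K) p = map_poly ratr p.
Proof. by apply: eq_map_poly => a; rewrite -(fmorph_eq_rat (in_alg K)). Qed.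

(** The coefficients of [minPoly 1 y] lie in the prime field, so the polynomial descends to [rat];
    this links [minPoly] with [min_polyQ]. *)
Lemma minPoly1_rat (K : fieldExtType rat) (y : K) :
  exists p : {poly rat}, [/\ p \is monic, irreducible_poly p &
    map_poly ratr p = minPoly 1 y].
Proof.
have /polyOver1P [p mp] := minPolyOver 1 y.
exists p; split; last by rewrite -map_poly_in_alg mp.
  by have := monic_minPoly 1 y; rewrite mp map_monic.
split.
  by have := size_minPoly 1 y; rewrite mp size_map_poly => ->.
move=> q q1 qp.
have : map_poly (in_alg K) q %| minPoly 1 y by rewrite mp dvdp_map.
move=> /(minPoly_irr (alg_polyOver _ _)); rewrite mp eqp_map => /orP [//|].
rewrite -[X in _ %= X](rmorph1 (map_poly (in_alg K))) eqp_map.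
by rewrite -size_poly_eq1 (negPf q1).
Qed.

Lemma minPoly1_dvdp (K : fieldExtType rat) (y : K) (p q : {poly rat}) :
  map_poly ratr p = minPoly 1 y -> root (map_poly ratr q) y -> p %| q.
Proof.
move=> mp qy; rewrite -(dvdp_map (in_alg K)) !map_poly_in_alg mp.
by apply: minPoly_dvdp => //; rewrite -map_poly_in_alg alg_polyOver.
Qed.

Lemma primitive_element_exists (K : fieldExtType rat) :
  exists x : K, <<1; x>>%VS = {:K}%VS.
Proof.
exists (separable_generator 1 {:K}); rewrite -eq_adjoin_separable_generator //.
  apply/separableP => y _; apply: pcharf0_separable => p.
  by rewrite (fmorph_pchar (in_alg K)); exact: pchar_num.
exact: sub1v.
Qed.

(** With [a] the leading coefficient of [q] and [n + 1] its degree, the monic integer polynomial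
    [a^n q(X / a)] vanishes at [a y]. *)
Lemma lead_coef_mul_integral (F : fieldType) (y : F) (q : {poly int}) :
  q != 0 -> root (map_poly intr q) y -> (1 < size q)%N ->
  integralOver (intr : int -> F) ((lead_coef q)%:~R * y).
Proof.
move=> q0 qy sq; set a := lead_coef q; set n := (size q).-2.
have sqE : size q = n.+2 by rewrite /n; case: (size q) sq => [|[]].
(* The top coefficient is set apart because the natural number [n - i] is truncated at
   [i = n + 1]. *)
pose Q := \poly_(i < n.+2) (if i == n.+1 then 1 else a ^+ (n - i) * q`_i).
have sQ : size Q = n.+2 by rewrite size_poly_eq // eqxx oner_neq0.
exists Q; first by rewrite monicE lead_coefE sQ /= coef_poly ltnSn eqxx.
rewrite rootE (horner_coef_wide _ (n := n.+2)); last first.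
  by rewrite -sQ; apply: size_poly.
move: qy; rewrite rootE (horner_coef_wide _ (n := n.+2)); last first.
  by rewrite -sqE; apply: size_poly.
move=> /eqP qy; apply/eqP.
transitivity (a%:~R ^+ n * 0 : F); last exact: mulr0.
rewrite -[X in _ = _ * X]qy mulr_sumr; apply: eq_bigr => -[i ilt] _ /=.
rewrite !coef_map /= coef_poly ilt.
rewrite exprMn mulrA; case: eqP => [->|/eqP ne].
  by rewrite mul1r exprSr /a lead_coefE sqE.
have le : (i <= n)%N by move: ilt; rewrite ltnS leq_eqVlt (negPf ne) ltnS.
rewrite rmorphM rmorphXn mulrA; congr (_ * _).
by rewrite mulrAC -exprD subnK // mulrC [RHS]mulrC.
Qed.

Lemma integral_multiple_exists (K : fieldExtType rat) (y : K) :
  exists2 a : int, a != 0 & integralOver (intr : int -> K) (a%:~R * y).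
Proof.
have [p [p_mon p_irr pE]] := minPoly1_rat y.
have [q [a a0 qE]] := rat_poly_scale p.
have q0 : q != 0.
  by apply: contraTneq p_mon => q0; rewrite qE q0 rmorph0 scaler0 monicE lead_coef0.
have a0' : a%:~R != 0 :> rat by rewrite intr_eq0.
exists (lead_coef q); first by rewrite lead_coef_eq0.
apply: lead_coef_mul_integral => //; last first.
  have := p_irr.1; rewrite qE size_scale ?invr_eq0 //.
  by rewrite size_map_inj_poly //; apply: intr_inj.
have : root (map_poly ratr p) y by rewrite pE root_minPoly.
rewrite qE -(map_poly_in_alg K) linearZ /= rootZ; last first.
  by rewrite scaler_eq0 oner_eq0 orbF invr_eq0.
rewrite -map_poly_comp (eq_map_poly (_ : _ =1 intr)) // => i /=.
by rewrite scaler_int.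
Qed.

Lemma integral_primitive_element_exists (K : fieldExtType rat) :
  exists2 x : K, <<1; x>>%VS = {:K}%VS & integralOver (intr : int -> K) x.
Proof.
have [y gy] := primitive_element_exists K.
have [a a0 iay] := integral_multiple_exists y.
exists (a%:~R * y) => //; apply/eqP; rewrite eqEsubv subvf /= -gy.
apply/FadjoinP; split; first exact: sub1v.
have aE : a%:~R = a%:~R%:A :> K by rewrite scaler_int.
have yE : y = (a%:~R : rat)^-1 *: (a%:~R * y).
  by rewrite aE -scalerAl mul1r scalerA mulVf ?scale1r // intr_eq0.
by rewrite [X in X \in _]yE memvZ // memv_adjoin.
Qed.

(** Each [w] is [q(y)] for some rational [q], and is sent to [q(z)]. Two choices of [q] differ by a
    multiple of [p], which vanishes at [z], so the value does not depend on the choice; additivity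
    and multiplicativity follow from this independence. *)
Lemma embedding_exists (K : fieldExtType rat) (F : numFieldType) (y : K)
    (p : {poly rat}) (z : F) :
  <<1; y>>%VS = {:K}%VS -> map_poly ratr p = minPoly 1 y ->
  root (map_poly ratr p) z ->
  exists sigma : {rmorphism K -> F}, sigma y = z.
Proof.
move=> gy pE pz.
have qex (w : K) : exists q : {poly rat}, (map_poly ratr q).[y] = w.
  have wy : w \in <<1; y>>%VS by rewrite gy memvf.
  have /polyOver1P [q qE] := Fadjoin_polyOver 1 y w.
  by exists q; rewrite -map_poly_in_alg -qE Fadjoin_poly_eq.
have [Q QE] := choice qex.
have Qz (q q' : {poly rat}) : (map_poly ratr q).[y] = (map_poly ratr q').[y] ->
    (map_poly ratr q).[z] = (map_poly ratr q').[z].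
  move=> qq'; apply/eqP; rewrite -subr_eq0 -hornerN -hornerD -rmorphB /=.
  apply/eqP/rootP; rewrite -dvdp_XsubCl.
  apply: (@dvdp_trans _ (map_poly ratr p)); first by rewrite dvdp_XsubCl.
  rewrite dvdp_map; apply: minPoly1_dvdp pE _.
  rewrite -map_poly_in_alg rmorphB /= !map_poly_in_alg rootE hornerD hornerN.
  by rewrite qq' subrr.
pose f w := (map_poly ratr (Q w)).[z].
have fB : zmod_morphism f.
  move=> u v; rewrite /f -hornerN -hornerD -rmorphB /=; apply: Qz.
  rewrite -[X in _ = X.[_]]map_poly_in_alg rmorphB /= !map_poly_in_alg.
  by rewrite hornerD hornerN !QE.
have fM : monoid_morphism f.
  split.
    rewrite /f -[RHS](hornerC _ z) -[X in _ = X.[_]](rmorph1 (map_poly ratr)).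
    by apply: Qz; rewrite QE -map_poly_in_alg rmorph1 hornerC.
  move=> u v; rewrite /f -hornerM -rmorphM /=; apply: Qz.
  rewrite -[X in _ = X.[_]]map_poly_in_alg rmorphM /= !map_poly_in_alg.
  by rewrite hornerM !QE.
pose g : {rmorphism K -> F} := HB.pack_for {rmorphism K -> F} f
  (GRing.isZmodMorphism.Build _ _ f fB) (GRing.isMonoidMorphism.Build _ _ f fM).
exists g; rewrite /= /f -[RHS](hornerX z) -[X in _ = X.[_]](map_polyX ratr).
by apply: Qz; rewrite QE -map_poly_in_alg map_polyX hornerX.
Qed.

Section EmbeddingSystem.
Variables (R : realType) (K : fieldExtType rat) (iota : {rmorphism K -> R}).
Local Notation C := R[i].

(** All embeddings are listed once, the given one at index [ord0]. The integral generator [x] labels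
    them: equality or conjugacy of embeddings is tested on values at [x]. *)
Record embedding_system (d : nat) (sg : 'I_d.+1 -> {rmorphism K -> C}) (x : K) :
    Prop := EmbeddingSystem {
  es_gen : <<1; x>>%VS = {:K}%VS;
  es_int : integralOver (intr : int -> K) x;
  es_dim : \dim {:K} = d.+1;
  es_inj : injective (fun k => sg k x);
  es_iota : forall y, sg ord0 y = (iota y)%:C;
  es_all : forall f : {rmorphism K -> C}, exists k, f =1 sg k }.

Lemma rat_poly_of_generator (x y : K) :
  <<1; x>>%VS = {:K}%VS ->
  exists2 q : {poly rat}, (size q <= \dim {:K})%N & y = (map_poly ratr q).[x].
Proof.
move=> gx; have yx : y \in <<1; x>>%VS by rewrite gx memvf.
have /polyOver1P [q qE] := Fadjoin_polyOver 1 x y.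
exists q; last by rewrite -map_poly_in_alg -qE Fadjoin_poly_eq.
rewrite -(size_map_poly (in_alg K)) -qE (leq_trans (size_Fadjoin_poly _ _ _)) //.
by rewrite adjoin_degreeE gx dimv1 divn1.
Qed.

Lemma generator_embedding_inj (x : K) (f g : {rmorphism K -> C}) :
  <<1; x>>%VS = {:K}%VS -> f x = g x -> f =1 g.
Proof.
move=> gx fgx y; have [q _ ->] := rat_poly_of_generator y gx.
by rewrite -!horner_map /= !map_poly_ratr fgx.
Qed.

Lemma embedding_system_exists :
  exists d (sg : 'I_d.+1 -> {rmorphism K -> C}) x, embedding_system sg x.
Proof.
have [x gx ix] := integral_primitive_element_exists K.
have [p [p_mon _ pE]] := minPoly1_rat x.
have [d dE] : exists d, \dim {:K} = d.+1.
  by exists (\dim {:K}).-1; rewrite prednK // adim_gt0.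
have sp : size p = d.+2.
  have := size_minPoly 1 x; rewrite -pE -map_poly_in_alg size_map_poly => ->.
  by rewrite adjoin_degreeE gx dimv1 divn1 dE.
have [rs] := closed_field_poly_normal (map_poly ratr p : {poly C}).
rewrite (monicP _) ?monic_map // scale1r => rsE.
have sep : separable_poly (map_poly ratr p : {poly C}).
  rewrite separable_map -(separable_map (in_alg K)) map_poly_in_alg pE.
  apply: (pcharf0_separable 1) => r.
  by rewrite (fmorph_pchar (in_alg K)); exact: pchar_num.
have rsU : uniq rs by rewrite -separable_prod_XsubC -rsE.
pose z0 : C := (iota x)%:C.
have pz0 : root (map_poly ratr p) z0.
  rewrite /z0 -[_%:C]/((real_complex R \o iota) x).
  rewrite -(map_poly_ratr (real_complex R \o iota)) fmorph_root pE.
  exact: root_minPoly.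
have z0rs : z0 \in rs by rewrite -root_prod_XsubC -rsE.
(* The distinct roots of the minimal polynomial of [x] give the embeddings; moving [iota x] to the
   front puts [iota] at index [ord0]. *)
pose zs := z0 :: rem z0 rs.
have zsP : perm_eq rs zs by apply: perm_to_rem.
have szs : size zs = d.+1.
  rewrite -(perm_size zsP); apply/succn_inj; rewrite -sp.
  by rewrite -(size_map_poly (ratr : {rmorphism rat -> C})) rsE size_prod_XsubC.
have mem_zs z : (z \in zs) = root (map_poly ratr p) z.
  by rewrite -(perm_mem zsP) -root_prod_XsubC -rsE.
have /choice [sg sgE] : forall k : 'I_d.+1,
    exists s : {rmorphism K -> C}, s x = nth 0 zs k.
  move=> k; apply: embedding_exists gx pE _.
  by rewrite -mem_zs mem_nth // szs.
exists d, sg, x; split=> //.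
- move=> k l /=; rewrite !sgE => /eqP.
  rewrite nth_uniq ?szs // => [/eqP/val_inj //|].
  by rewrite -(perm_uniq zsP).
- move=> y; rewrite -[_%:C]/((real_complex R \o iota) y).
  apply: (generator_embedding_inj (g := real_complex R \o iota) gx).
  by rewrite sgE.
- move=> f.
  have : f x \in zs.
    by rewrite mem_zs -(map_poly_ratr f) fmorph_root pE root_minPoly.
  move=> /(nthP 0) [k klt fxE]; rewrite szs in klt.
  exists (Ordinal klt); apply: generator_embedding_inj gx _.
  by rewrite sgE.
Qed.

Variables (d : nat) (sg : 'I_d.+1 -> {rmorphism K -> C}) (x : K).
Hypothesis (sys : embedding_system sg x).

(* If the minimal polynomial of [x] over [Q(y)] had a second root, it would be
   some [sg k x] with [k != 0], and [sg k] would agree with [iota] on [Q(y)]. *)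
Lemma generator_of_separated (y : K) :
  (forall k, k != ord0 -> sg k y != sg ord0 y) -> <<1; y>>%VS = {:K}%VS.
Proof.
move=> sep_y; have gx := es_gen sys.
pose E := <<1; y>>%AS.
have [p [_ _ pE]] := minPoly1_rat x.
have [q _ qE] := rat_poly_of_generator y gx.
have My : minPoly E x %| map_poly ratr q - y%:P.
  apply: minPoly_dvdp; last by rewrite rootE hornerD hornerN hornerC -qE subrr.
  rewrite rpredB // ?polyOverC ?memv_adjoin //.
  by rewrite -map_poly_in_alg alg_polyOver.
have Mp : minPoly E x %| map_poly ratr p by rewrite pE minPolyS ?sub1v.
have sepM : separable_poly (map_poly (sg ord0) (minPoly E x)).
  rewrite separable_map; apply: (pcharf0_separable E) => r.
  by rewrite (fmorph_pchar (in_alg K)); exact: pchar_num.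
have [ms] := closed_field_poly_normal (map_poly (sg ord0) (minPoly E x)).
rewrite (monicP _) ?map_monic ?monic_minPoly // scale1r => msE.
have msU : uniq ms by rewrite -separable_prod_XsubC -msE.
have ms0 : {subset ms <= [:: sg ord0 x]}.
  move=> z; rewrite -root_prod_XsubC -msE -dvdp_XsubCl => zM.
  have : root (map_poly (sg ord0) (map_poly ratr p)) z.
    by rewrite -dvdp_XsubCl (dvdp_trans zM) // dvdp_map.
  rewrite map_poly_ratr => pz.
  have [f fx] := embedding_exists gx pE pz.
  have [k fk] := es_all sys f.
  have : root (map_poly (sg ord0) (map_poly ratr q - y%:P)) z.
    by rewrite -dvdp_XsubCl (dvdp_trans zM) // dvdp_map.
  rewrite rmorphB /= map_poly_ratr map_polyC rootE hornerD hornerN hornerC.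
  rewrite -fx fk -(map_poly_ratr (sg k)) horner_map -qE subr_eq0 => sky.
  rewrite inE; case: (eqVneq k ord0) => [-> //|/sep_y].
  by rewrite sky.
have sms : (size ms <= 1)%N by exact: uniq_leq_size msU ms0.
have xE : x \in E.
  rewrite -adjoin_deg_eq1 eqn_leq /= andbT -ltnS -size_minPoly.
  by rewrite -(size_map_poly (sg ord0)) msE size_prod_XsubC.
apply/eqP; rewrite eqEsubv subvf /= -gx.
by apply/FadjoinP; split; first exact: sub1v.
Qed.

Lemma integral_iota (y : K) :
  integralOver (intr : int -> R) (iota y) <-> integralOver (intr : int -> K) y.
Proof.
have mE (p : {poly int}) : map_poly intr p = map_poly iota (map_poly intr p).
  by rewrite -map_poly_comp; apply: eq_map_poly => a /=; rewrite rmorph_int.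
by split=> -[p p_mon]; rewrite ?mE ?fmorph_root => py; exists p;
  rewrite // mE fmorph_root.
Qed.

(** The conjugates of [iota y] are the values [sg k y]. Conversely [|sg k y| < 1 < iota y] separates
    [iota] from the other embeddings, so these inequalities already force [y] to generate [K]. *)
Lemma wpKP (theta : R) :
  wpK iota theta <->
  exists2 y : K, iota y = theta &
    [/\ integralOver (intr : int -> K) y, 1 < iota y &
        forall k, k != ord0 -> `|sg k y| < 1].
Proof.
split.
  move=> [[it t1 conj_t] [y yt gy]]; subst theta; exists y => //; split=> //.
    exact/integral_iota.
  move=> k k0; apply: conj_t.
    have [p [p_mon p_irr pE]] := minPoly1_rat y.
    exists p.
      split=> //.
      by rewrite -(map_poly_ratr iota) fmorph_root pE root_minPoly.
    by rewrite -(map_poly_ratr (sg k)) fmorph_root pE root_minPoly.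
  rewrite -(es_iota sys); apply: contraNneq k0 => /(generator_embedding_inj gy).
  by move=> /(_ x) /(es_inj sys) ->.
move=> [y yt [iy y1 hy]]; subst theta.
have gy : <<1; y>>%VS = {:K}%VS.
  apply: generator_of_separated => k /hy ky; apply: contraTneq ky => ->.
  rewrite (es_iota sys) -real_leNgt ?ger0_real ?normr_ge0 // -[1]/(1%:C).
  by rewrite normc_def /= expr0n addr0 sqrtr_sqr lecR ltW // ger0_norm // ltW // (lt_trans ltr01).
split; last by exists y.
split=> //; first exact/integral_iota.
move=> z [p [p_mon p_irr py] pz] zy.
have py' : root (map_poly ratr p) y.
  by move: py; rewrite -(map_poly_ratr iota) fmorph_root.
have [m [m_mon m_irr mE]] := minPoly1_rat y.
have mp : m %| p := minPoly1_dvdp mE py'.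
(* [conjugateQ] provides some monic irreducible polynomial vanishing at the point; being divisible
   by the minimal polynomial, it equals it. *)
have mpE : m = p.
  apply/eqP; rewrite -eqp_monic //; apply: p_irr.2 => //.
  by rewrite neq_ltn m_irr.1 orbT.
rewrite -mpE in pz.
have [f fy] := embedding_exists gy mE pz.
have [k fk] := es_all sys f.
rewrite -fy fk; apply: hy; apply: contraNneq zy => k0.
by rewrite -fy fk k0 (es_iota sys).
Qed.

End EmbeddingSystem.

(** * Norms of algebraic integers *)

(** The integral equation has integer coefficients, so it descends to [rat] and passes to [algC],
    where rational algebraic integers are known to be integers. *)
Lemma integral_rat_int (F : numFieldType) (r : rat) :
  integralOver (intr : int -> F) (ratr r) -> exists m : int, r = m%:~R.
Proof.
move=> [p p_mon].
have mE (L : numFieldType) : map_poly intr p = map_poly ratr (map_poly intr p) :> {poly L}.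
  by rewrite -map_poly_comp; apply: eq_map_poly => a /=; rewrite ratr_int.
rewrite mE fmorph_root => pr.
have : root (map_poly intr p) (ratr r : algC) by rewrite mE fmorph_root.
have mon : map_poly intr p \is @monic algC by rewrite monic_map.
move=> /root_monic_Aint /(_ mon) rA.
have /intrP [m mr] : (ratr r : algC) \is a Num.int.
  apply: Cint_rat_Aint; first exact: Crat_rat.
  apply: rA; apply/polyOverP => i; rewrite coef_map /=; exact: intr_int.
exists m; apply: (fmorph_inj (ratr : {rmorphism rat -> algC})).
by rewrite /= ratr_int; exact: mr.
Qed.

Section Norms.
Variables (R : realType) (K : fieldExtType rat) (iota : {rmorphism K -> R}).
Local Notation C := R[i].
Variables (d : nat) (sg : 'I_d.+1 -> {rmorphism K -> C}) (x : K).
Hypothesis (sys : embedding_system iota sg x).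

Lemma integral_embedding (f : {rmorphism K -> C}) (y : K) :
  integralOver (intr : int -> K) y -> integralOver (intr : int -> C) (f y).
Proof.
move=> [p p_mon py]; exists p => //.
have -> : map_poly intr p = map_poly f (map_poly intr p).
  by rewrite -map_poly_comp; apply: eq_map_poly => a /=; rewrite rmorph_int.
by rewrite fmorph_root.
Qed.

Definition conj_mx : 'M[C]_d.+1 := \matrix_(j, k) (sg k x) ^+ j.

Lemma conj_mx_unit : conj_mx \in unitmx.
Proof.
have -> : conj_mx = Vandermonde d.+1 (\row_k sg k x).
  by apply/matrixP => j k; rewrite !mxE.
rewrite unitmxE det_Vandermonde unitfE; apply/prodf_neq0 => i _.
apply/prodf_neq0 => j ij; rewrite !mxE subr_eq0.
by apply: contraTneq ij => /(es_inj sys) ->; rewrite ltnn.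
Qed.

(** Multiplication by [y] has a rational matrix [A] in the basis of powers of [x], and the
    Vandermonde matrix [conj_mx] diagonalises it with eigenvalues [sg k y]. So the product is the
    rational number [det A], and it is an algebraic integer. *)
Lemma norm_integer (y : K) :
  integralOver (intr : int -> K) y -> exists m : int, \prod_k sg k y = m%:~R.
Proof.
move=> iy.
have /choice [q qE] : forall j : 'I_d.+1, exists q : {poly rat},
    (size q <= d.+1)%N /\ y * x ^+ j = (map_poly ratr q).[x].
  move=> j; have [q sq qE] := rat_poly_of_generator (y * x ^+ j) (es_gen sys).
  by exists q; split=> //; rewrite (es_dim sys) in sq.
pose A := \matrix_(j < d.+1, l < d.+1) (q j)`_l.
pose D := \row_k sg k y.
have AV : map_mx ratr A *m conj_mx = conj_mx *m diag_mx D.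
  apply/matrixP => j k; rewrite mul_mx_diag !mxE.
  rewrite mulrC -rmorphXn -rmorphM (qE j).2 -horner_map /= map_poly_ratr.
  rewrite (horner_coef_wide _ (n := d.+1)) ?size_map_poly ?(qE j).1 //.
  by apply: eq_bigr => l _; rewrite !mxE coef_map.
have dE : ratr (\det A) = \prod_k sg k y.
  transitivity (\det (diag_mx D)); last first.
    by rewrite det_diag; apply: eq_bigr => k _; rewrite !mxE.
  apply: (@mulIf _ (\det conj_mx)).
    by have := conj_mx_unit; rewrite unitmxE unitfE.
  by rewrite -det_map_mx -det_mulmx AV det_mulmx mulrC.
have [|m mE] := @integral_rat_int C (\det A); last first.
  by exists m; rewrite -dE mE ratr_int.
rewrite dE; apply: big_ind => //; first exact: integral1.
  exact: integral_mul.
by move=> k _; apply: integral_embedding.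
Qed.

(** The norm is a nonzero integer, hence of modulus at least 1, and its [d] factors other than
    [sg k y] are at most [B]. *)
Lemma conjugate_lower_bound (y : K) (k : 'I_d.+1) (B : C) :
  integralOver (intr : int -> K) y -> y != 0 ->
  (forall l, l != k -> `|sg l y| <= B) -> 1 <= `|sg k y| * B ^+ d.
Proof.
move=> iy y0 yB; have [m mE] := norm_integer iy.
apply: (@le_trans _ _ `|\prod_l sg l y|).
  rewrite mE -intr_norm -[1]/(1%:~R) ler_int.
  rewrite -gtz0_ge1 normr_gt0 -(intr_eq0 C) -mE.
  by apply/prodf_neq0 => l _; rewrite fmorph_eq0.
rewrite normr_prod (bigD1 k) //= ler_wpM2l //.
have dE : #|[pred l : 'I_d.+1 | l != k]| = d.
  by rewrite (cardC1 k) card_ord.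
rewrite -[X in B ^+ X]dE -prodr_const; apply: ler_prod => l lk.
by rewrite normr_ge0 yB.
Qed.

End Norms.

(** * Approximation by algebraic integers *)

Lemma norm_real_complex (F : rcfType) (r : F) : `|r%:C| = `|r|%:C.
Proof. by rewrite normc_def /= expr0n addr0 sqrtr_sqr. Qed.

Lemma Re_ge0K (F : rcfType) (u : F[i]) : 0 <= u -> (complex.Re u)%:C = u.
Proof. by move=> u0; rewrite RRe_real // ger0_real. Qed.

(** Pigeonhole: cut the unit cube into [N^n] boxes of side [1/N]. Among [N^n + 1] multiples of [b],
    two have fractional parts in the same box, and [q] is the difference of their multipliers. *)
Lemma simultaneous_dirichlet (R : realType) (n N : nat) (b : 'I_n -> R) : (0 < N)%N ->
  exists q (a : 'I_n -> int), (0 < q)%N /\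
    forall j, `|q%:R * b j - (a j)%:~R| <= N%:R^-1.
Proof.
move=> N0; have NR : 0 < N%:R :> R by rewrite ltr0n.
pose fr (q : nat) j := q%:R * b j - (Num.floor (q%:R * b j))%:~R.
have fr0 q j : 0 <= fr q j by rewrite subr_ge0 floor_le.
have fr1 q j : fr q j < 1 by rewrite ltrBlDl -[1]/(1%:~R) -intrD floorD1_gt.
have bx q j : (Num.truncn (N%:R * fr q j) < N)%N.
  rewrite truncn_lt_nat ?mulr_ge0 ?ler0n //.
  by rewrite -[ltRHS]mulr1 ltr_pM2l.
pose f (q : 'I_(#|{ffun 'I_n -> 'I_N}|.+1)) : {ffun 'I_n -> 'I_N} :=
  [ffun j => Ordinal (bx q j)].
have /injectivePn [q1 [q2 q12 fq]] : ~~ injectiveb f.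
  by apply/injectiveP => /leq_card; rewrite card_ord ltnn.
wlog lt12 : q1 q2 q12 fq / (q1 < q2)%N.
  move=> th; case: (ltngtP q1 q2) => [lt|gt|/val_inj eq]; first exact: th fq lt.
    by apply: (th q2 q1); rewrite // eq_sym.
  by rewrite eq eqxx in q12.
exists (q2 - q1)%N, (fun j => Num.floor (q2%:R * b j) - Num.floor (q1%:R * b j)).
split=> [|j]; first by rewrite subn_gt0.
have -> : (q2 - q1)%:R * b j -
    (Num.floor (q2%:R * b j) - Num.floor (q1%:R * b j))%:~R = fr q2 j - fr q1 j.
  by rewrite natrB ?(ltnW lt12) // intrB /fr; ring.
have : val (f q1 j) = val (f q2 j) by rewrite fq.
rewrite !ffunE /= => tE.
have NV : N%:R^-1 * N%:R = 1 :> R by rewrite mulVf // gt_eqF.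
rewrite -(ler_pM2r NR) NV -[X in _ * X]ger0_norm ?ler0n // -normrM mulrBl.
rewrite ![_ * N%:R]mulrC.
have /andP [l1 u1] := truncn_itv (mulr_ge0 (ler0n R N) (fr0 q1 j)).
have /andP [l2 u2] := truncn_itv (mulr_ge0 (ler0n R N) (fr0 q2 j)).
rewrite tE in l1 u1; rewrite -natr1 in u1 u2.
rewrite ler_norml; apply/andP; split.
  by rewrite lerBrDl lerBlDr (le_trans (ltW u1)) // lerD2r.
by rewrite lerBlDl (le_trans (ltW u2)) // lerD2r.
Qed.

Section Approximation.
Variables (R : realType) (K : fieldExtType rat) (iota : {rmorphism K -> R}).
Local Notation C := R[i].
Variables (d : nat) (sg : 'I_d.+1 -> {rmorphism K -> C}) (x : K).
Hypothesis (sys : embedding_system iota sg x).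

(** This describes the image of the real algebra [K ⊗ R] in the product of the complex
    embeddings. *)
Definition conj_compat (w : 'I_d.+1 -> C) :=
  forall k l, sg l x = (sg k x)^*%C -> w l = (w k)^*%C.

Lemma conj_index k : exists l, forall y, sg l y = (sg k y)^*%C.
Proof. by have [l lE] := es_all sys (@conjc R \o sg k); exists l => y; rewrite -lE. Qed.

Lemma conj_compat_embedding y : conj_compat (fun k => sg k y).
Proof.
move=> k l lk.
by apply: (generator_embedding_inj (g := @conjc R \o sg k) (es_gen sys)).
Qed.

Lemma conj_ord0 k l : sg l x = (sg k x)^*%C -> (l == ord0) = (k == ord0).
Proof.
have z0 : (sg ord0 x)^*%C = sg ord0 x by rewrite (es_iota sys) conjc_real.
move=> lk; apply/eqP/eqP => [l0|k0].
  by apply: (es_inj sys); rewrite /= -z0 -l0 lk conjcK.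
by apply: (es_inj sys); rewrite /= lk k0.
Qed.

(** Inverting the Vandermonde matrix gives complex coefficients [u]. By compatibility their
    conjugates solve the same system, hence so does the average, which is the real part. *)
Lemma real_interpolation w : conj_compat w ->
  exists r : 'I_d.+1 -> R, forall k, \sum_j (r j)%:C * sg k x ^+ j = w k.
Proof.
move=> wJ; pose u := \row_k w k *m invmx (conj_mx sg x).
have uE k : \sum_j u ord0 j * sg k x ^+ j = w k.
  have : u *m conj_mx sg x = \row_k w k by rewrite mulmxKV ?(conj_mx_unit sys).
  move=> /matrixP /(_ ord0 k); rewrite !mxE => <-.
  by apply: eq_bigr => j _; rewrite !mxE.
exists (fun j => complex.Re (u ord0 j)) => k.
have uJ : \sum_j (u ord0 j)^*%C * sg k x ^+ j = w k.
  have [l lk] := conj_index k.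
  rewrite -[RHS]conjcK -(wJ k l) // -uE raddf_sum.
  by apply: eq_bigr => j _; rewrite /= rmorphM rmorphXn /= lk conjcK.
transitivity ((w k + w k) / 2%:R); last first.
  by rewrite -mulr2n -(mulr_natr (w k)) mulfK ?pnatr_eq0.
rewrite -{1}uE -uJ -big_split mulr_suml; apply: eq_bigr => j _ /=.
by rewrite ReJ_add -mulrDl mulrAC.
Qed.

Lemma integral_int_combination (a : 'I_d.+1 -> int) :
  integralOver (intr : int -> K) (\sum_j (a j)%:~R * x ^+ j).
Proof.
apply: big_ind => [||j _]; [exact: integral0|exact: integral_add|].
apply: integral_mul; first exact: integral_id.
elim: (nat_of_ord j) => [|n IH]; first exact: integral1.
by rewrite exprS; apply: integral_mul => //; exact: es_int sys.
Qed.

(** The constant depends only on the conjugates of [x], so it can be fixed before the precision [e]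
    is chosen. *)
Lemma rounding_bound : exists2 S : R, 0 < S &
  forall (a : 'I_d.+1 -> int) (r : 'I_d.+1 -> R) (e : R) k,
  (forall j, `|r j - (a j)%:~R| <= e) ->
  `|\sum_j (r j)%:C * sg k x ^+ j - sg k (\sum_j (a j)%:~R * x ^+ j)|
     <= (e * S)%:C.
Proof.
pose S := \sum_k \sum_(j < d.+1) `|sg k x| ^+ j.
have S0 k : 0 <= \sum_(j < d.+1) `|sg k x| ^+ j.
  by apply: sumr_ge0 => j _; rewrite exprn_ge0.
have SE : (complex.Re S)%:C = S by rewrite Re_ge0K //; apply: sumr_ge0 => k _.
exists (complex.Re S + 1).
  by rewrite ltr_wpDl // -ler0c SE; apply: sumr_ge0 => k _.
move=> a r e k ae.
have e0 : 0 <= e by apply: le_trans (ae ord0).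
rewrite raddf_sum -sumrB.
apply: (@le_trans _ _ (\sum_(j < d.+1) e%:C * `|sg k x| ^+ j)).
  apply: (le_trans (ler_norm_sum _ _ _)); apply: ler_sum => j _.
  rewrite /= rmorphM rmorphXn /= rmorph_int -mulrBl normrM normrX.
  rewrite ler_wpM2r ?exprn_ge0 //.
  by rewrite -(rmorph_int (real_complex R)) -rmorphB /= norm_real_complex lecR.
rewrite -mulr_sumr rmorphM ler_wpM2l ?ler0c // rmorphD /= SE.
apply: (@le_trans _ _ S); last by rewrite lerDl ler01.
by rewrite /S [leRHS](bigD1 k) //= lerDl sumr_ge0.
Qed.

(** Let [r] be the real coordinates of the vector equal to 1 at [iota] and 0 elsewhere. Dirichlet
    makes some [q r] nearly integral; the rounded element has value near [q] at [iota] and near 0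
    elsewhere. *)
Lemma small_conjugates (eta : R) : 0 < eta -> exists alpha : K,
  [/\ integralOver (intr : int -> K) alpha, alpha != 0 &
      forall k, k != ord0 -> `|sg k alpha| < eta%:C].
Proof.
move=> eta0; have [S S0 Sb] := rounding_bound.
have wJ : conj_compat (fun k => (k == ord0)%:R).
  by move=> k l /conj_ord0 ->; case: eqP; rewrite ?conjc1 ?conjc0.
have [r rE] := real_interpolation wJ.
(* The cap at 1 yields [alpha != 0]: otherwise [q], which is at least 1, would be below [eta']. *)
pose eta' := Num.min eta 1.
have eta'0 : 0 < eta' by rewrite lt_min eta0 ltr01.
pose N := (Num.truncn (S / eta')).+1.
have NS : N%:R^-1 * S < eta'.
  rewrite mulrC ltr_pdivrMr ?ltr0n // mulrC -ltr_pdivrMr //.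
  exact: truncnS_gt.
have [q [a [q0 aE]]] := @simultaneous_dirichlet R _ N r isT.
pose alpha := \sum_j (a j)%:~R * x ^+ j.
have ak k : `|(q%:R * (k == ord0)%:R) - sg k alpha| < eta'%:C.
  apply: le_lt_trans (_ : _ <= (N%:R^-1 * S)%:C) _; last by rewrite ltcR.
  apply: le_trans (Sb a (fun j => q%:R * r j) _ k aE).
  rewrite -rE mulr_sumr; under eq_bigr do rewrite mulrA -(rmorph_nat (real_complex R)) -rmorphM.
  by [].
exists alpha; split; first exact: integral_int_combination.
  apply: contraTneq (ak ord0) => ->.
  rewrite eqxx mulr1 rmorph0 subr0 normr_nat -real_leNgt ?realE ?ler0n ?ler0c ?(ltW eta'0) //.
  apply: (@le_trans _ _ 1); last by rewrite ler1n.
  by rewrite -[1]/(1%:C) lecR ge_min lexx orbT.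
move=> k k0; have := ak k; rewrite (negPf k0) mulr0 sub0r normrN => /lt_le_trans.
by apply; rewrite lecR ge_min lexx.
Qed.

(** The targets are divided by the conjugates of [alpha], the solution is rounded at cost [S], and
    multiplying back by [alpha] shrinks the error to [|sg k alpha| S < eta] away from [iota]. *)
Lemma approximation (c : 'I_d.+1 -> R) (eta B : R) :
  (forall k l, sg l x = (sg k x)^*%C -> c l = c k) -> 0 < eta ->
  exists theta : K,
  [/\ integralOver (intr : int -> K) theta, B < iota theta &
      forall k, k != ord0 -> `|sg k theta - (c k)%:C| < eta%:C].
Proof.
move=> cJ eta0; have [S S0 Sb] := rounding_bound.
have [alpha [ia a0 ak]] := small_conjugates (divr_gt0 eta0 S0).
(* At [iota] the error can be as large as [|iota alpha| S]; the target allows for it and still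
   leaves a value above [B]. *)
pose c' k := if k == ord0 then B + 1 + `|iota alpha| * S else c k.
pose w k := (c' k)%:C / sg k alpha.
have wJ : conj_compat w.
  move=> k l lk; rewrite /w (conj_compat_embedding alpha lk) -conjc_inv.
  rewrite -[X in X * _]conjc_real -rmorphM /c' (conj_ord0 lk).
  by case: eqP => // _; rewrite (cJ k l).
have [r rE] := real_interpolation wJ.
pose tau := \sum_j (Num.floor (r j))%:~R * x ^+ j.
have tk k : `|w k - sg k tau| <= S%:C.
  rewrite -rE -[S]mul1r; apply: Sb => j.
  have := floor_itv (r j); rewrite intrD => /andP [lr ur].
  by rewrite ler_norml; lra.
have thk k : `|(c' k)%:C - sg k (alpha * tau)| <= `|sg k alpha| * S%:C.
  have -> : (c' k)%:C - sg k (alpha * tau) = sg k alpha * (w k - sg k tau).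
    by rewrite rmorphM mulrBr /w [_ * (_ / _)]mulrC divfK // fmorph_eq0.
  by rewrite normrM ler_wpM2l.
exists (alpha * tau); split.
- by apply: integral_mul => //; apply: integral_int_combination.
- have := thk ord0; rewrite !(es_iota sys) -rmorphB !norm_real_complex -rmorphM lecR.
  by rewrite /c' eqxx ler_norml => /andP [_ hu]; lra.
- move=> k k0; rewrite distrC; have := thk k; rewrite /c' (negPf k0).
  move=> /le_lt_trans; apply.
  have : eta%:C = (eta / S)%:C * S%:C.
    by rewrite -rmorphM /= divfK // gt_eqF.
  by move=> ->; rewrite ltr_pM2r ?ak // -[0]/(0%:C) ltcR.
Qed.

End Approximation.

(** * Gaps of discrete sets and of Pisot numbers *)

Section DiscreteSets.
Variables (R : realType) (A : set R).

Lemma discrete_successor (c B : R) : 0 < c ->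
  (forall a b, A a -> A b -> a < b -> c <= b - a) ->
  (exists2 a, A a & B < a) ->
  exists a, [/\ A a, B < a & forall b, A b -> B < b -> a <= b].
Proof.
move=> c0 Ac [a0 Aa0 Ba0].
pose E := [set a | A a /\ B < a].
have hE : has_inf E.
  by split; [exists a0 | exists B => b [_ /ltW]].
(* An element within [c] of the infimum is the least one: a smaller element would lie at least [c]
   lower, below the infimum. *)
have [a [Aa Ba] aE] := inf_adherent c0 hE.
exists a; split=> // b Ab Bb; rewrite leNgt; apply/negP => ba.
have := Ac _ _ Ab Aa ba.
have : inf E <= b by apply: ge_inf; [exact: hE.2 | split].
by move=> h1 h2; lra.
Qed.

(** Iterate the successor from the lower bound [m]. An element missed by the iteration would stay
    above every [theta n], although [theta n] grows at least like [n c]. *)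
Lemma increasing_enum_exists (c m : R) : 0 < c ->
  (forall a b, A a -> A b -> a < b -> c <= b - a) ->
  (forall a, A a -> m < a) -> (forall B, exists2 a, A a & B < a) ->
  exists theta, increasing_enum A theta.
Proof.
move=> c0 Ac Am AB.
have /choice [nxt nxtP] := fun B => discrete_successor c0 Ac (AB B).
pose theta n := iter n nxt (nxt m).
have Ath n : A (theta n) by case: n => [|n]; [case: (nxtP m) | case: (nxtP (theta n))].
have thS n : theta n < theta n.+1 by case: (nxtP (theta n)).
exists theta; split; first exact: (homo_ltn (@lt_trans _ _)).
apply/seteqP; split=> [_ [n _ <-] //|b Ab]; apply: contrapT => nb.
have neq n : theta n != b by apply/eqP => e; apply: nb; exists n.
have lt_b n : theta n < b.
  elim: n => [|n IH]; rewrite lt_neqAle neq /theta /=.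
    by case: (nxtP m) => _ _; apply=> //; exact: Am.
  by case: (nxtP (theta n)) => _ _; apply.
have ge_n n : theta 0%N + n%:R * c <= theta n.
  elim: n => [|n IH]; first by rewrite mul0r addr0.
  have := Ac _ _ (Ath n) (Ath n.+1) (thS n).
  by rewrite -natr1; lra.
have := ge_n (Num.truncn ((b - theta 0%N) / c)).+1.
have := truncnS_gt ((b - theta 0%N) / c); rewrite ltr_pdivrMr // => h1 h2.
have := lt_b (Num.truncn ((b - theta 0%N) / c)).+1; lra.
Qed.

Lemma increasing_enum_next (theta : nat -> R) (a b : R) :
  increasing_enum A theta -> A a -> A b -> a < b ->
  exists2 n, theta n = a & theta n.+1 <= b.
Proof.
move=> [mono <-] [n _ <-] [k _ <-] ltab; exists n => //.
have mono' : {homo theta : i j / (i <= j)%N >-> i <= j}.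
  by move=> i j; rewrite leq_eqVlt => /predU1P [-> //|/mono/ltW].
suff nk : (n < k)%N by exact: mono'.
by rewrite ltnNge; apply/negP => /mono'; rewrite leNgt ltab.
Qed.

End DiscreteSets.

(* As [z] is within [eta] of [-s], the point [w - s] has modulus less than
   [1 + eta], which for [s * Re w <= 0] would force [`|w| ^+ 2 < 3 eta]. *)
Lemma sign_of_displacement (R : rcfType) (s eta : R) (z w : R[i]) :
  s ^+ 2 = 1 -> eta <= 1 ->
  `|z + s%:C| < eta%:C -> `|z + w| < 1 -> (3 * eta)%:C <= `|w| ^+ 2 ->
  0 < s * complex.Re w.
Proof.
move=> s1 eta1 zs zw hw.
have eta0 : 0 < eta by rewrite -ltcR; apply: le_lt_trans zs; exact: normr_ge0.
have : `|w - s%:C| < (1 + eta)%:C.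
  have -> : w - s%:C = (z + w) - (z + s%:C) by ring.
  by rewrite (le_lt_trans (ler_normB _ _)) // rmorphD ltrD.
rewrite -(@ltr_pXn2r _ 2) ?nnegrE ?normr_ge0 //; last by rewrite ler0c; lra.
rewrite -(rmorphXn (real_complex R) 2 (1 + eta)); move: hw.
rewrite -!add_Re2_Im2 lecR ltcR; case: w {zw} => u v /=.
by move=> h1 h2; nra.
Qed.

Section Gaps.
Variables (R : realType) (K : fieldExtType rat) (iota : {rmorphism K -> R}).
Local Notation C := R[i].
Variables (d : nat) (sg : 'I_d.+1 -> {rmorphism K -> C}) (x : K).
Hypothesis (sys : embedding_system iota sg x).

(** Away from [iota] the conjugates of the difference have modulus at most 2, so the norm bounds its
    value at [iota] below. *)
Lemma wpK_discrete a b : wpK iota a -> wpK iota b -> a < b ->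
  (2 ^+ d)^-1 <= b - a.
Proof.
move=> /(wpKP sys) [y <- [iy _ hy]] /(wpKP sys) [y' <- [iy' _ hy']] ab.
have nz : y' - y != 0 by rewrite subr_eq0; apply: contraTneq ab => ->; rewrite ltxx.
have hd l : l != ord0 -> `|sg l (y' - y)| <= 2.
  move=> l0; rewrite rmorphB (le_trans (ler_normB _ _)) //.
  by rewrite -[2]/(1 + 1) lerD // ltW // ?hy ?hy'.
have := conjugate_lower_bound sys (integral_sub iy' iy) nz hd.
rewrite (es_iota sys) norm_real_complex -(rmorph_nat (real_complex R)).
rewrite -rmorphXn -rmorphM -[1]/(1%:C) lecR rmorphB /= ger0_norm; last by rewrite subr_ge0 ltW.
by rewrite -ler_pdivrMr ?exprn_gt0 // div1r.
Qed.

Lemma wpK_enum_exists : exists theta, increasing_enum (wpK iota) theta.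
Proof.
have c0 : 0 < (2 ^+ d)^-1 :> R by rewrite invr_gt0 exprn_gt0.
apply: (increasing_enum_exists (m := 1) c0 wpK_discrete).
  by move=> a /(wpKP sys) [y <- []].
move=> B.
(* Approximating 0 at all other embeddings yields arbitrarily large elements. *)
have [y [iy yB hy]] := approximation sys (c := fun=> 0) (Num.max B 1)
  (fun _ _ _ => erefl) ltr01.
move: yB; rewrite gt_max => /andP [yB y1].
exists (iota y) => //; apply/(wpKP sys); exists y => //; split=> // k /hy.
by rewrite subr0.
Qed.

Lemma gap_with_signs (e : 'I_d.+1 -> bool) :
  (forall k l, sg l x = (sg k x)^*%C -> e l = e k) ->
  exists y, CK iota (iota y) /\
    forall k, k != ord0 -> 0 < (-1) ^+ e k * complex.Re (sg k y).
Proof.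
move=> eJ; pose s k : R := (-1) ^+ e k.
have sJ k l : sg l x = (sg k x)^*%C -> s l = s k by move=> /eJ; rewrite /s => ->.
have s2 k : s k ^+ 2 = 1 by rewrite sqrr_sign.
have ns k : `|s k| = 1 by rewrite normr_sign.
have half0 : 0 < 2^-1 :> R by rewrite invr_gt0.
have [beta [ib b0 hb]] := approximation sys 0 sJ half0.
(* [M] will bound every conjugate of the gap: [iota beta] at [iota], and 2 elsewhere as a difference
   of two points of the unit disc. The norm then gives the lower bound [rho]. *)
pose M := Num.max (iota beta) 2.
have M0 : 0 < M by rewrite lt_max orbC ltr0n.
have M2 : 2 <= M by rewrite le_max lexx orbT.
pose rho := (M ^+ d)^-1.
have rho0 : 0 < rho by rewrite invr_gt0 exprn_gt0.
have rho1 : rho <= 1.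
  by rewrite invf_le1 ?exprn_gt0 // exprn_ege1 // (le_trans _ M2) // ler1n.
(* Chosen so that [3 eta = rho^2], the threshold in [sign_of_displacement]. [M], [rho] and [eta]
   depend on [beta] but not on [theta]. *)
pose eta := rho ^+ 2 / 3.
have eta0 : 0 < eta by rewrite divr_gt0 ?exprn_gt0.
have eta3 : eta <= 3^-1.
  by rewrite -[leRHS]mul1r ler_wpM2r ?invr_ge0 // expr_le1 // ltW.
(* The target is [- s k] pulled inside the disc by [eta / 2]; an approximation within [eta / 2]
   stays in the open disc and within [eta] of [- s k]. *)
pose c k := - (s k * (1 - eta / 2)).
have cJ k l : sg l x = (sg k x)^*%C -> c l = c k by move=> /sJ; rewrite /c => ->.
have [theta [it t1 ht]] := approximation sys 1 cJ (divr_gt0 eta0 (ltr0n R 2)).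
have ht1 k : k != ord0 -> `|sg k theta| < 1.
  move=> k0; rewrite -(subrK (c k)%:C (sg k theta)).
  rewrite (le_lt_trans (ler_normD _ _)) //.
  have -> : 1 = (eta / 2)%:C + (1 - eta / 2)%:C :> C by rewrite -rmorphD addrC subrK.
  rewrite ltr_leD ?ht // norm_real_complex lecR normrN normrM ns mul1r ger0_norm //.
  by lra.
have hts k : k != ord0 -> `|sg k theta + (s k)%:C| < eta%:C.
  move=> k0; rewrite -(subrK (c k)%:C (sg k theta)) -addrA.
  rewrite (le_lt_trans (ler_normD _ _)) //.
  have -> : eta%:C = (eta / 2)%:C + (eta / 2)%:C :> C.
    by rewrite -rmorphD; congr (_%:C); lra.
  rewrite ltr_leD ?ht // -rmorphD norm_real_complex lecR /c.
  have -> : - (s k * (1 - eta / 2)) + s k = s k * (eta / 2) by ring.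
  by rewrite normrM ns mul1r ger0_norm //; lra.
have Wt : wpK iota (iota theta) by apply/(wpKP sys); exists theta.
(* The opposite targets cancel, leaving conjugates of modulus below [eta + 1/2 < 1]. *)
have Wtb : wpK iota (iota (theta + beta)).
  apply/(wpKP sys); exists (theta + beta) => //; split=> //.
  - exact: integral_add.
  - by rewrite rmorphD /=; lra.
  - move=> k k0; rewrite rmorphD.
    have -> : sg k theta + sg k beta =
        (sg k theta + (s k)%:C) + (sg k beta - (s k)%:C) by ring.
    rewrite (le_lt_trans (ler_normD _ _)) //.
    rewrite (lt_trans (ltrD (hts k k0) (hb k k0))) // -rmorphD -(rmorph1 (real_complex R)) ltcR.
    by lra.
have [th th_enum] := wpK_enum_exists.
have lt_tb : iota theta < iota (theta + beta) by rewrite rmorphD /=; lra.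
have [n thn thn1] := increasing_enum_next th_enum Wt Wtb lt_tb.
have : wpK iota (th n.+1) by rewrite -th_enum.2; exists n.+1.
move=> /(wpKP sys) [y1 y1E [iy1 _ hy1]].
have lt_t : iota theta < iota y1 by rewrite y1E -thn; apply: th_enum.1.
exists (y1 - theta); split.
  by exists th => //; exists n; rewrite rmorphB /= y1E thn.
have nz : y1 - theta != 0.
  by rewrite subr_eq0; apply: contraTneq lt_t => ->; rewrite ltxx.
have bound l : `|sg l (y1 - theta)| <= M%:C.
  have [->|l0] := eqVneq l ord0.
    rewrite (es_iota sys) norm_real_complex lecR rmorphB /=.
    rewrite ger0_norm; last by rewrite subr_ge0 ltW.
    rewrite le_max; apply/orP; left.
    by move: thn1; rewrite -y1E rmorphD /=; lra.
  rewrite rmorphB (le_trans (ler_normB _ _)) //.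
  apply: (@le_trans _ _ (2%:R)%:C); last by rewrite lecR.
  by rewrite -[2%:R]/(1 + 1) rmorphD lerD // ltW // ?hy1 ?ht1.
move=> k k0.
have low := conjugate_lower_bound sys (k := k) (integral_sub iy1 it) nz
  (fun l _ => bound l).
have rho_low : rho%:C <= `|sg k (y1 - theta)|.
  have MdC : 0 < (M ^+ d)%:C by rewrite -(rmorph0 (real_complex R)) ltcR exprn_gt0.
  rewrite -(ler_pM2r MdC) -rmorphM mulVf ?gt_eqF ?exprn_gt0 // rmorphXn.
  exact: low.
apply: (sign_of_displacement (eta := eta) (z := sg k theta)) => //.
- exact: s2.
- by lra.
- exact: hts.
- by rewrite -rmorphD addrC subrK hy1.
- have -> : 3 * eta = rho ^+ 2 by rewrite /eta mulrC divfK ?pnatr_eq0.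
  by rewrite rmorphXn ler_pXn2r ?nnegrE ?normr_ge0 // ler0c ltW.
Qed.

End Gaps.

(** * Counting sign patterns *)

Lemma card_finset (T : finType) (A : {set T}) : [set` A] #= `I_#|A|.
Proof.
have <- : range (@enum_val T (mem A)) = [set` A].
  apply/seteqP; split=> [_ [i _ <-]|a aA]; first exact: enum_valP.
  by exists (enum_rank_in aA a); rewrite // enum_rankK_in.
rewrite (card_eql (inj_card_eq (in2W enum_val_inj))) card_eq_sym.
exact: card_II.
Qed.

Lemma card_image_finset (T : finType) (U : Type) (f : T -> U) (A : {set T}) n :
  injective f -> f @` [set` A] #= `I_n -> #|A| = n.
Proof.
move=> f_inj; rewrite (card_eql (inj_card_eq (in2W f_inj))).
by rewrite (card_eql (card_finset A)) => /card_eq_II.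
Qed.

Section Counting.
Variables (R : realType) (K : fieldExtType rat) (iota : {rmorphism K -> R}).
Local Notation C := R[i].
Variables (d : nat) (sg : 'I_d.+1 -> {rmorphism K -> C}) (x : K).
Hypothesis (sys : embedding_system iota sg x).

Lemma embedding_fun_inj : injective (fun k => sg k : K -> C).
Proof. by move=> k l kl; apply: (es_inj sys); rewrite /= kl. Qed.

Lemma real_embedding_conj k :
  (forall y, sg k y \is Num.real) <-> (sg k x)^*%C = sg k x.
Proof.
split=> [/(_ x) /complex_realP [r ->] | kJ y]; first exact: conjc_real.
have kk : sg k x = (sg k x)^*%C by [].
have := conj_compat_embedding sys y kk.
by case: (sg k y) => u v [] /eqP; rewrite complex_real -subr_eq0 opprK -mulr2n mulrn_eq0.
Qed.

Lemma card_real_index s : real_embeddings R K #= `I_s ->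
  #|[set k | (sg k x)^*%C == sg k x]%SET| = s.
Proof.
move=> card_real; apply: card_image_finset embedding_fun_inj _.
suff -> : (fun k => sg k : K -> C) @`
  [set` [set k | (sg k x)^*%C == sg k x]%SET] = real_embeddings R K by [].
apply/seteqP; split=> [_ [k kJ <-]|f [[sigma ->] sreal]].
  split; first by exists (sg k).
  by move: kJ; rewrite /= inE => /eqP /real_embedding_conj.
have [k kE] := es_all sys sigma.
have kE' : (sg k : K -> C) = sigma by apply/funext => y; rewrite kE.
exists k => //=; rewrite inE; apply/eqP/real_embedding_conj => y.
by rewrite kE'; apply: sreal.
Qed.

Lemma card_nonreal_index m : nonreal_embeddings R K #= `I_m ->
  #|[set k | (sg k x)^*%C != sg k x]%SET| = m.
Proof.
move=> card_nonreal; apply: card_image_finset embedding_fun_inj _.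
suff -> : (fun k => sg k : K -> C) @`
  [set` [set k | (sg k x)^*%C != sg k x]%SET] = nonreal_embeddings R K by [].
apply/seteqP; split=> [_ [k kJ <-]|f [[sigma ->] sreal]].
  split; first by exists (sg k).
  by move: kJ; rewrite /= inE => /eqP kJ /real_embedding_conj.
have [k kE] := es_all sys sigma.
have kE' : (sg k : K -> C) = sigma by apply/funext => y; rewrite kE.
exists k => //=; rewrite inE; apply/eqP => /real_embedding_conj kr.
by apply: sreal => y; rewrite -kE'; exact: kr.
Qed.

(** The archimedean places other than [iota]: the sign of the imaginary part at [x] selects one
    embedding from each non-real conjugate pair. *)
Definition places : {set 'I_d.+1} :=
  [set k | (k != ord0) && (0 <= complex.Im (sg k x))]%SET.

(** Conjugation exchanges the embeddings with [sg k x] in the upper and lower half-planes, so each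
    half contains [t] of them; the real ones other than [iota] number [s - 1]. *)
Lemma card_places s t : real_embeddings R K #= `I_s ->
  nonreal_embeddings R K #= `I_(2 * t)%N -> #|places| = (s + t - 1)%N.
Proof.
move=> /card_real_index rs /card_nonreal_index rt.
have JE k : ((sg k x)^*%C == sg k x) = (complex.Im (sg k x) == 0).
  case: (sg k x) => u v; rewrite eq_complex /= eqxx /= -subr_eq0 -opprD oppr_eq0.
  by rewrite -mulr2n mulrn_eq0.
pose Np := [set k | 0 < complex.Im (sg k x)]%SET.
pose Nn := [set k | complex.Im (sg k x) < 0]%SET.
have /choice [kb kbE] := fun k => conj_index sys k.
have kb_inj : injective kb.
  move=> k l kl; apply: (es_inj sys); rewrite /=.
  by rewrite -[LHS]conjcK -[RHS]conjcK -!kbE kl.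
have le_kb (A B : {set 'I_d.+1}) : (forall k, k \in A -> kb k \in B) ->
    (#|A| <= #|B|)%N.
  move=> AB; rewrite -(card_imset _ kb_inj); apply: subset_leq_card.
  by apply/fintype.subsetP => _ /imsetP [k kA ->]; apply: AB.
have ImJ k : complex.Im (sg (kb k) x) = - complex.Im (sg k x).
  by rewrite kbE; case: (sg k x).
have NpNn : #|Np| = #|Nn|.
  by apply/eqP; rewrite eqn_leq !le_kb // => k; rewrite !inE ImJ ?oppr_lt0 ?oppr_gt0.
have Npt : #|Np| = t.
  have NE : [set k | (sg k x)^*%C != sg k x]%SET = Np :|: Nn.
    by apply/setP => k; rewrite !inE JE neq_lt orbC.
  have dis : Np :&: Nn = finset.set0.
    by apply/setP => k; rewrite !inE; apply/andP => -[/lt_trans h /h]; rewrite ltxx.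
  have := rt; rewrite NE cardsU dis cards0 subn0 -NpNn addnn -mul2n => /eqP.
  by rewrite eqn_pmul2l // => /eqP.
pose Rk := [set k | (sg k x)^*%C == sg k x]%SET.
have R0 : ord0 \in Rk by rewrite inE (es_iota sys) conjc_real.
have PE : places = Rk :\ ord0 :|: Np.
  apply/setP => k; rewrite !inE JE le_eqVlt (eq_sym 0).
  case: eqVneq => [->|//] /=.
  by rewrite (es_iota sys) /= ltxx.
have dis : (Rk :\ ord0) :&: Np = finset.set0.
  apply/setP => k; rewrite !inE JE; apply/negP => /andP [/andP [_ /eqP ->]].
  by rewrite ltxx.
rewrite PE cardsU dis cards0 subn0 Npt.
have := cardsD1 ord0 Rk; rewrite R0 rs => ->.
by rewrite add1n addSn subn1.
Qed.

Lemma gap_of_signs (A : {set 'I_d.+1}) : A \subset places ->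
  exists y, CK iota (iota y) /\ forall k, k \in places ->
    (k \in A) = (complex.Re (sg k y) < 0).
Proof.
move=> /fintype.subsetP AP; have /choice [kb kbE] := fun k => conj_index sys k.
have kbE' k l : sg l x = (sg k x)^*%C -> l = kb k.
  by move=> lk; apply: (es_inj sys); rewrite /= lk kbE.
have kbK k : kb (kb k) = k by apply/esym/kbE'; rewrite kbE conjcK.
(* The pattern is made invariant under conjugation. It still agrees with [A] on [places], because a
   place whose conjugate is also in [places] is real. *)
pose e k := (k \in A) || (kb k \in A).
have [|y [yC hy]] := @gap_with_signs _ _ _ _ _ _ sys e.
  by move=> k l /kbE' ->; rewrite /e kbK orbC.
exists y; split=> // k kP; have := kP; rewrite inE => /andP [k0 Imk].
have -> : (k \in A) = e k.
  rewrite /e; case kbA: (kb k \in A); last by rewrite orbF.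
  have := AP _ kbA; rewrite inE kbE => /andP [_].
  case zE : (sg k x) Imk => [u v] /= v0; rewrite oppr_ge0 => v0'.
  suff <- : kb k = k by rewrite kbA.
  apply/esym/kbE'; rewrite zE /= (_ : v = 0) ?oppr0 //.
  by apply/eqP; rewrite eq_le v0 v0'.
have := hy k k0; case: (e k); rewrite ?expr1 ?mulN1r ?oppr_gt0 ?expr0 ?mul1r => //.
by move=> /ltW; rewrite leNgt => /negbTE ->.
Qed.

End Counting.

Theorem corollary3 (R : realType) (K : fieldExtType rat)
    (iota : {rmorphism K -> R}) (s t : nat)
    (s_ge1 : (1 <= s)%N)
    (card_real : real_embeddings R K #= `I_s)
    (card_nonreal : nonreal_embeddings R K #= `I_(2 * t)%N) :
  `I_(2 ^ (s + t - 1))%N #<= CK iota.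
Proof.
have [d [sg [x sys]]] := embedding_system_exists iota.
have cP := card_places sys card_real card_nonreal.
(* Outside the powerset of [places], [y] takes the dummy value 0. *)
have /choice [y yP] : forall A : {set 'I_d.+1}, exists y, A \subset places sg x ->
    CK iota (iota y) /\ forall k, k \in places sg x ->
      (k \in A) = (complex.Re (sg k y) < 0).
  move=> A; case: (boolP (A \subset places sg x)) => [/(gap_of_signs sys)|_].
    by move=> [y yP]; exists y.
  by exists 0.
(* The gap determines [A], read off from the signs of the real parts of its conjugates. *)
have y_inj : {in [set` powerset (places sg x)] &, injective (iota \o y)}.
  move=> A B; rewrite !inE /= !powersetE => AP BP /fmorph_inj yAB.
  have [_ hA] := yP A AP; have [_ hB] := yP B BP.
  apply/setP => k; have [kP|kP] := boolP (k \in places sg x).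
    by rewrite hA // hB // yAB.
  have out (D : {set 'I_d.+1}) : D \subset places sg x -> (k \in D) = false.
    by move=> /fintype.subsetP DP; apply: contraNF kP => /DP.
  by rewrite !out.
have := card_finset (powerset (places sg x)).
rewrite card_powerset cP card_eq_sym card_eq_le => /andP [le _].
apply: card_le_trans le _.
have := inj_card_eq y_inj; rewrite card_eq_sym card_eq_le => /andP [le' _].
apply: card_le_trans le' _; apply: subset_card_le => _ [A + <-].
by rewrite /= powersetE => /yP [].
Qed.
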